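(* Let $s\ge1$ be an integer. For the polynomial approximation $\sigma$ of degree at most $s$ defined by $\sigma(0)=y_0$ and $$\dot\sigma(ch)=\sum_{i=0}^{s-1}P_i(c)\,\Gamma_i^s(\sigma),\qquad c\in[0,1],\qquad \Gamma_i^s(\sigma)=\sum_{j=0}^{s-1}\rho_{ij}(\sigma)\gamma_j(\sigma),\quad i=0,\dots,s-1,$$ with $y_1:=\sigma(h)$, one has $$y_1-y(h)=O(h^{2s+1})\qquad (h\to0),$$ where $y(t)$ is the solution of $\dot y=S(y)\nabla H(y)$, $y(0)=y_0$.
   Context: Consider the problem $\dot y=S(y)\nabla H(y)=:f(y)$, $t\in[0,h]$, $y(0)=y_0\in\mathbb{R}^m$, where $H$ is real-valued and $S(y)=-S(y)^\top$ is an $m\times m$ skew-symmetric matrix for every $y$. $S$ and $\nabla H$ are assumed to be of class $C^\infty$ in a neighborhood of $y_0$. $\{P_i\}_{i\ge0}$ denotes the Legendre polynomial basis orthonormal on $[0,1]$: $P_i$ has degree $i$, $P_0\equiv 1$, and $\int_0^1P_i(x)P_j(x)\,dx=\delta_{ij}$. For a path $\sigma:[0,h]\to\mathbb{R}^m$ define $$\gamma_j(\sigma)=\int_0^1P_j(\tau)\nabla H(\sigma(\tau h))\,d\tau,\qquad \rho_{ij}(\sigma)=\int_0^1P_i(\tau)P_j(\tau)S(\sigma(\tau h))\,d\tau .$$ The dot denotes the derivative with respect to time $t=ch$. The polynomial $\sigma=\sigma_h$ depends on the stepsize $h$; for all sufficiently small $h>0$ it is taken to be a solution of its defining equations whose values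 on $[0,h]$ remain in a fixed compact neighborhood of $y_0$ on which $S$ and $H$ are smooth. The $O(\cdot)$ symbol refers to $h\to0^+$ with $s$, $y_0$, $S$, $H$ fixed. *)

(* Defs.v *)
From HB Require Import structures.
From mathcomp Require Import all_boot all_order all_algebra.
From mathcomp Require Import all_classical all_reals all_analysis.

Set Implicit Arguments.
Unset Strict Implicit.
Unset Printing Implicit Defensive.

Import Order.TTheory GRing.Theory Num.Theory.
Import numFieldNormedType.Exports.

Local Open Scope classical_set_scope.
Local Open Scope ring_scope.

(* [is_Ck k U f]: f is of class C^k on the open set U, i.e. f is differentiable
   on U and all its directional derivatives are of class C^(k-1) on U.  This is
   the usual notion when V is finite-dimensional and U is open. *)
Fixpoint is_Ck (R : realType) (V W : normedModType R) (k : nat) (U : set V)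
    (f : V -> W) : Prop :=
  match k with
  | 0 => forall x, U x -> {for x, continuous f}
  | k'.+1 => (forall x, U x -> differentiable f x) /\
             (forall v : V, is_Ck k' U ('D_v f))
  end.

Definition is_smooth (R : realType) (V W : normedModType R) (U : set V)
    (f : V -> W) : Prop :=
  forall k, is_Ck k U f.

Definition grad (R : realType) (m : nat) (H : 'cV[R]_m -> R) (x : 'cV[R]_m) :
    'cV[R]_m :=
  \col_k 'D_(delta_mx k 0) H x.

(* Derivative of f at t relative to D: one-sided at an end point of an
   interval D. *)
Definition has_derivative_within (R : realType) (V : normedModType R)
    (D : set R) (f : R -> V) (t : R) (v : V) : Prop :=
  (fun u : R => (u - t)^-1 *: (f u - f t)) @ within D t^' --> v.

Definition is_solution (R : realType) (m : nat) (S : 'cV[R]_m -> 'M[R]_m)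
    (H : 'cV[R]_m -> R) (y0 : 'cV[R]_m) (T : R) (y : R -> 'cV[R]_m) : Prop :=
  y 0 = y0 /\
  forall t : R, t \in `[0, T] ->
    has_derivative_within `[0, T] y t (S (y t) *m grad H (y t)).

(* The orthonormal Legendre polynomials on [0, 1]; these conditions determine
   each P i, 0 < i, up to its sign, which is left free. *)
Definition orthonormal_legendre (R : realType) (P : nat -> {poly R}) : Prop :=
  [/\ forall i, size (P i) = i.+1,
      P 0%N = 1 &
      forall i j, \int[lebesgue_measure]_(x in `[0, 1]) ((P i).[x] * (P j).[x])
                  = (i == j)%:R].

Section coefficients.
Variables (R : realType) (m : nat) (P : nat -> {poly R}).
Variables (S : 'cV[R]_m -> 'M[R]_m) (H : 'cV[R]_m -> R) (h : R).
Implicit Types sigma : R -> 'cV[R]_m.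

Definition gamma sigma (j : nat) : 'cV[R]_m :=
  \col_k \int[lebesgue_measure]_(tau in `[0, 1])
           ((P j).[tau] * grad H (sigma (tau * h)) k 0).

Definition rho sigma (i j : nat) : 'M[R]_m :=
  \matrix_(k, l) \int[lebesgue_measure]_(tau in `[0, 1])
                   ((P i).[tau] * (P j).[tau] * S (sigma (tau * h)) k l).

Definition Gamma (s : nat) sigma (i : nat) : 'cV[R]_m :=
  \sum_(0 <= j < s) rho sigma i j *m gamma sigma j.

End coefficients.

Definition poly_path (R : realType) (m : nat) (p : 'cV[{poly R}]_m) (t : R) :
    'cV[R]_m :=
  \col_k (p k 0).[t].

(* [p] is a polynomial in the time variable t = c h, not in c. *)
Definition is_approximation (R : realType) (m s : nat) (P : nat -> {poly R})
    (S : 'cV[R]_m -> 'M[R]_m) (H : 'cV[R]_m -> R) (y0 : 'cV[R]_m) (h : R)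
    (p : 'cV[{poly R}]_m) : Prop :=
  [/\ forall k, (size (p k 0%R) <= s.+1)%N,
      poly_path p 0 = y0 &
      forall c : R, c \in `[0, 1] ->
        (poly_path p)^`()%classic (c * h) =
        \sum_(0 <= i < s) (P i).[c] *: Gamma P S H h s (poly_path p) i].

(* Main.v *)
(* The numerical path and the exact solution are compared through the Taylor
   polynomial of the flow: with L g = sum_k f_k D_k g the derivative along the
   field f = S grad H, put
     phi(c) = sum_(n <= 2s) (h (1 - c))^n / n! (L^n x_k)(x(c)),   c in [0, 1].
   Along the exact solution x(c) = y(c h) only the last term of phi' survives
   and phi(1) - phi(0) = O(h^(2s+1)).  Along x(c) = sigma(c h) there remains
   h times the integral of sum_j B_j (sigma'_j - f_j(x)), where
   sigma' = Pi (S Pi grad H) for the L^2 projection Pi onto polynomials of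
   degree < s.  By induction on n <= s, every smooth function of x(c) is
   O(h^n) close to a polynomial of degree < n in c whose l-th coefficient is
   O(h^l): this property passes through sums, products and Pi, hence to
   sigma', and integrating sigma' raises n by one.  For n = s, a factor a and a
   function u with this property satisfy int a (Pi u - u) = O(h^(2s)), since
   Pi u - u is O(h^s) and orthogonal to the polynomial part of a.  The value
   phi(0) is the same for both paths. *)

Require Import Defs.
From HB Require Import structures.
From mathcomp Require Import all_boot all_order all_algebra.
From mathcomp Require Import all_classical all_reals all_analysis.
From mathcomp Require Import ring.

Import Order.TTheory GRing.Theory Num.Theory.
Import numFieldNormedType.Exports.

Local Open Scope classical_set_scope.
Local Open Scope ring_scope.

Set Implicit Arguments.
Unset Strict Implicit.

(** * Continuity and integration on the unit interval *)

Section unit_interval.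
Context {R : realType}.
Implicit Types (u v w : R -> R) (p q : {poly R}).

(** Continuity is two-sided even at 0 and 1, which is available because the numerical paths are
    differentiable there in the ordinary sense. *)
Definition cont01 u := forall c : R, c \in `[0, 1] -> {for c, continuous u}.

Definition int01 u : R := \int[lebesgue_measure]_(x in `[0, 1]) u x.

Lemma cont01_cst (a : R) : cont01 (fun=> a).
Proof. by move=> c _; exact: cst_continuous. Qed.

Lemma cont01D u v : cont01 u -> cont01 v -> cont01 (fun c => u c + v c).
Proof. by move=> cu cv c cI; apply: cvgD; [exact: cu|exact: cv]. Qed.

Lemma cont01B u v : cont01 u -> cont01 v -> cont01 (fun c => u c - v c).
Proof. by move=> cu cv c cI; apply: cvgB; [exact: cu|exact: cv]. Qed.

Lemma cont01M u v : cont01 u -> cont01 v -> cont01 (fun c => u c * v c).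
Proof. by move=> cu cv c cI; apply: cvgM; [exact: cu|exact: cv]. Qed.

Lemma cont01_sum (I : Type) (r : seq I) (u : I -> R -> R) :
  (forall i, cont01 (u i)) -> cont01 (fun c => \sum_(i <- r) u i c).
Proof.
move=> cu; elim: r => [|i r IHr].
  by under eq_fun do rewrite big_nil; exact: cont01_cst.
by under eq_fun do rewrite big_cons; exact: cont01D.
Qed.

Lemma cont01_horner p : cont01 (horner p).
Proof. by move=> c _; exact: continuous_horner. Qed.

Lemma cont01_integrable u : cont01 u ->
  lebesgue_measure.-integrable `[0, 1]%classic (EFin \o u).
Proof.
move=> cu; apply: continuous_compact_integrable; first exact: segment_compact.
by apply: continuous_subspace_itv => c cI; exact: cu.
Qed.

Lemma eq_int01 u v : (forall c : R, c \in `[0, 1] -> u c = v c) ->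
  int01 u = int01 v.
Proof. by move=> uv; apply: eq_Rintegral => c; rewrite inE => /uv. Qed.

Lemma int01D u v : cont01 u -> cont01 v ->
  int01 (fun c => u c + v c) = int01 u + int01 v.
Proof. by move=> cu cv; apply: RintegralD => //; exact: cont01_integrable. Qed.

Lemma int01B u v : cont01 u -> cont01 v ->
  int01 (fun c => u c - v c) = int01 u - int01 v.
Proof. by move=> cu cv; apply: RintegralB => //; exact: cont01_integrable. Qed.

Lemma int01Zl (a : R) u : cont01 u -> int01 (fun c => a * u c) = a * int01 u.
Proof. by move=> cu; apply: RintegralZl => //; exact: cont01_integrable. Qed.

Lemma int01_cst (a : R) : int01 (fun=> a) = a.
Proof.
rewrite /int01 Rintegral_cst//= lebesgue_measure_itv/= lte01 oppr0 adde0 /=.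
by rewrite mulr1.
Qed.

Lemma int01_sum (I : Type) (r : seq I) (u : I -> R -> R) :
  (forall i, cont01 (u i)) ->
  int01 (fun c => \sum_(i <- r) u i c) = \sum_(i <- r) int01 (u i).
Proof.
move=> cu; elim: r => [|i r IHr].
  by under eq_int01 do rewrite big_nil; rewrite big_nil int01_cst.
rewrite big_cons -IHr -int01D//; last exact: cont01_sum.
by under eq_int01 do rewrite big_cons.
Qed.

Lemma normr_int01_le u (M : R) : cont01 u ->
  (forall c : R, c \in `[0, 1] -> `|u c| <= M) -> `|int01 u| <= M.
Proof.
move=> cu uM; rewrite -[leRHS]int01_cst.
apply: (le_trans (le_normr_Rintegral _ _)) => //.
  exact: cont01_integrable.
apply: le_Rintegral => //.
- by apply: cont01_integrable => c cI; apply: cvg_norm; exact: cu.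
- by apply: cont01_integrable; exact: cont01_cst.
Qed.

Lemma int01_derive (F u : R -> R) : cont01 u ->
  (forall c : R, c \in `[0, 1] -> is_derive c 1 F (u c)) -> int01 u = F 1 - F 0.
Proof.
move=> cu dF; have cF : cont01 F.
  move=> c cI; apply: differentiable_continuous; apply/derivable1_diffP.
  by have [] := dF c cI.
rewrite /int01 /Rintegral (@continuous_FTC2 _ u F) //.
- by apply: continuous_subspace_itv => c cI; exact: cu.
- split.
  + by move=> c cI; have [|//] := dF c; apply: subset_itv_oo_cc.
  + by apply: cvg_at_right_filter; apply: cF; rewrite in_itv/= lexx ler01.
  + by apply: cvg_at_left_filter; apply: cF; rewrite in_itv/= lexx ler01.
- move=> c cI; rewrite derive1E; have [|_ <-//] := dF c.
  exact: subset_itv_oo_cc.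
Qed.

End unit_interval.

(** * Orthogonal projection onto polynomials of degree < s *)

Section legendre_projection.
Context {R : realType} (P : nat -> {poly R}).
Hypothesis P_legendre : orthonormal_legendre P.
Implicit Types (u v : R -> R) (p q : {poly R}).

(** The L^2-orthogonal projection Pi, written through Legendre coefficients. *)
Definition lproj (s : nat) u : {poly R} :=
  \sum_(i < s) int01 (fun c => (P i).[c] * u c) *: P i.

Let size_legendre i : size (P i) = i.+1. Proof. by case: P_legendre. Qed.

Let int01_legendre i j :
  int01 (fun c => (P i).[c] * (P j).[c]) = (i == j)%:R.
Proof. by case: P_legendre => _ _; apply. Qed.

(** Induction on s: as [P s] has exact degree s, subtracting a multiple of it removes the
    coefficient of degree s. *)
Lemma legendre_span s q : (size q <= s)%N ->
  exists a : 'I_s -> R, q = \sum_(i < s) a i *: P i.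
Proof.
elim: s q => [|s IHs] q sq.
  by exists (fun=> 0); rewrite big_ord0; apply/eqP; rewrite -size_poly_leq0.
have l0 : lead_coef (P s) != 0.
  by rewrite lead_coef_eq0 -size_poly_eq0 size_legendre.
pose a := q`_s / lead_coef (P s).
have [|b qE] := IHs (q - a *: P s).
  apply/leq_sizeP => j; rewrite leq_eqVlt => /predU1P[<-|sj].
    rewrite coefB coefZ /a -[X in (P s)`_X]/(s.+1.-1) -(size_legendre s).
    by rewrite -/(lead_coef _) divfK// subrr.
  rewrite coefB coefZ !nth_default ?mulr0 ?subrr//; last exact: leq_trans sq _.
  by rewrite size_legendre.
(* The coefficients [b] are extended from ['I_s] to ['I_s.+1]: [insub] fails exactly at the index s,
   where the default [a] is taken. *)
exists (fun i => oapp b a (insub (i : nat))).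
rewrite big_ord_recr/= insubN ?ltnn//=; apply/eqP; rewrite -subr_eq qE.
by apply/eqP/eq_bigr => i _; rewrite valK.
Qed.

Lemma cont01_legendre i u : cont01 u -> cont01 (fun c => (P i).[c] * u c).
Proof. by move=> cu; apply: cont01M => //; exact: cont01_horner. Qed.

Lemma int01_legendre_sum s (a : 'I_s -> R) (i : 'I_s) :
  int01 (fun c => (P i).[c] * (\sum_(j < s) a j *: P j).[c]) = a i.
Proof.
transitivity (int01 (fun c => \sum_(j < s) a j * ((P i).[c] * (P j).[c]))).
  apply: eq_int01 => c _; rewrite horner_sum mulr_sumr.
  by apply: eq_bigr => j _; rewrite hornerZ mulrCA.
have cP j : cont01 (fun c => (P i).[c] * (P j).[c]).
  by apply: cont01_legendre; exact: cont01_horner.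
rewrite int01_sum; last by move=> j; apply: cont01M => //; exact: cont01_cst.
under eq_bigr do rewrite int01Zl// int01_legendre.
rewrite (bigD1 i)//= eqxx mulr1 big1 ?addr0// => j ji.
by rewrite (inj_eq val_inj) eq_sym (negbTE ji) mulr0.
Qed.

(** Against each [P i] with i < s, the function u and its projection have the same integral; p is a
    combination of these [P i]. *)
Lemma int01_lproj_orthogonal s p u : cont01 u -> (size p <= s)%N ->
  int01 (fun c => p.[c] * ((lproj s u).[c] - u c)) = 0.
Proof.
move=> cu /legendre_span[a ->].
have cl : cont01 (fun c => (lproj s u).[c] - u c).
  by apply: cont01B => //; exact: cont01_horner.
transitivity (int01 (fun c =>
    \sum_(i < s) a i * ((P i).[c] * ((lproj s u).[c] - u c)))).
  apply: eq_int01 => c _; rewrite horner_sum mulr_suml.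
  by apply: eq_bigr => i _; rewrite hornerZ mulrA.
rewrite int01_sum; last first.
  by move=> i; apply: cont01M; [exact: cont01_cst|exact: cont01_legendre].
rewrite big1// => i _; rewrite int01Zl; last exact: cont01_legendre.
under eq_int01 do rewrite mulrBr.
rewrite int01B; try exact: cont01_legendre.
  by rewrite int01_legendre_sum subrr mulr0.
by apply: cont01_legendre; exact: cont01_horner.
Qed.

Lemma lproj_horner s q : (size q <= s)%N -> lproj s (horner q) = q.
Proof.
move=> /legendre_span[a ->]; apply: eq_bigr => i _.
by rewrite int01_legendre_sum.
Qed.

Lemma lprojB s u v : cont01 u -> cont01 v ->
  lproj s (fun c => u c - v c) = lproj s u - lproj s v.
Proof.
move=> cu cv; rewrite /lproj -sumrB; apply: eq_bigr => i _.
rewrite -scalerBl -int01B; try exact: cont01_legendre.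
by under eq_int01 do rewrite mulrBr.
Qed.

Lemma horner_bounded01 p : exists2 C : R, 0 <= C &
  forall c, c \in `[0, 1] -> `|p.[c]| <= C.
Proof.
exists (\sum_(i < size p) `|p`_i|); first exact: sumr_ge0.
move=> c; rewrite in_itv/= => /andP[c0 c1]; rewrite horner_coef.
apply: (le_trans (ler_norm_sum _ _ _)); apply: ler_sum => i _.
by rewrite normrM normrX ler_piMr// exprn_ile1// ger0_norm.
Qed.

(** If C_i bounds |P_i| on [0, 1], the i-th coefficient is at most C_i M and its polynomial brings
    another C_i. The constant does not depend on u, hence later not on h. *)
Lemma lproj_bounded s : exists2 C : R, 0 <= C & forall u (M : R), cont01 u ->
  (forall c, c \in `[0, 1] -> `|u c| <= M) ->
  forall c, c \in `[0, 1] -> `|(lproj s u).[c]| <= C * M.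
Proof.
have /choice[C CP] i : exists C : R, 0 <= C /\
    forall c, c \in `[0, 1] -> `|(P i).[c]| <= C.
  by have [C C0 CP] := horner_bounded01 (P i); exists C.
exists (\sum_(i < s) C i * C i).
  by apply: sumr_ge0 => i _; have [C0 _] := CP i; exact: mulr_ge0.
move=> u M cu uM c cI; rewrite horner_sum mulr_suml.
apply: (le_trans (ler_norm_sum _ _ _)); apply: ler_sum => i _.
have [C0 CPi] := CP i; rewrite hornerZ normrM -mulrA mulrC.
apply: ler_pM => //; first exact: CPi.
apply: normr_int01_le => [|t tI]; first exact: cont01_legendre.
by rewrite normrM; apply: ler_pM => //; [exact: CPi|exact: uM].
Qed.

End legendre_projection.

(** * Polynomial approximation on [0, 1], uniformly as h tends to 0 *)

Section uniform_approximation.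
Context {R : realType}.
Implicit Types (u v : R -> R -> R) (q : {poly R}) (C h c : R) (n N : nat).

(* The coefficient of c^l is O(h^l), as for a polynomial in t = c h with
   bounded coefficients. *)
Definition scaled_poly N C h q :=
  (size q <= N)%N /\ forall l, `|q`_l| <= C * h ^+ l.

(** The property carried by the induction on n. One constant, independent of h, serves for both the
    coefficients and the error. *)
Definition approx n u := exists2 C : R, 0 <= C &
  \forall h \near 0^'+, exists2 q, scaled_poly n C h q &
    forall c, c \in `[0, 1] -> `|u h c - q.[c]| <= C * h ^+ n.

Definition near_le01 (M : R -> R) u :=
  \forall h \near 0^'+, forall c, c \in `[0, 1] -> `|u h c| <= M h.

Definition right_bigO n (F : R -> R) := exists2 C : R, 0 <= C &
  \forall h \near 0^'+, `|F h| <= C * h ^+ n.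

Lemma near_right01 : \forall h \near (0:R)^'+, 0 < h <= 1.
Proof.
near=> h; apply/andP; split; near: h; first exact: nbhs_right_gt.
exact: nbhs_right_le.
Unshelve. all: by end_near. Qed.

Lemma right_bigO_ext n (F G : R -> R) :
  (\forall h \near 0^'+, F h = G h) -> right_bigO n F -> right_bigO n G.
Proof.
move=> FG [C C0 HF]; exists C => //.
by move: FG HF; apply: filterS2 => h ->.
Qed.

Lemma right_bigOD n (F G : R -> R) : right_bigO n F -> right_bigO n G ->
  right_bigO n (fun h => F h + G h).
Proof.
move=> [C C0 HF] [D D0 HG]; exists (C + D); first exact: addr_ge0.
move: HF HG; apply: filterS2 => h FC GD; rewrite mulrDl.
by apply: (le_trans (ler_normD _ _)); exact: lerD.
Qed.

Lemma right_bigON n (F : R -> R) : right_bigO n F ->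
  right_bigO n (fun h => - F h).
Proof.
move=> [C C0 HF]; exists C => //.
by move: HF; apply: filterS => h; rewrite normrN.
Qed.

Lemma right_bigO_sum n (I : Type) (r : seq I) (F : I -> R -> R) :
  (forall i, right_bigO n (F i)) -> right_bigO n (fun h => \sum_(i <- r) F i h).
Proof.
move=> HF; elim: r => [|i r IHr].
  by exists 0 => //; apply: nearW => h; rewrite big_nil normr0 mul0r.
apply: right_bigO_ext (right_bigOD (HF i) IHr).
by apply: nearW => h; rewrite big_cons.
Qed.

Lemma right_bigO_mulh n (F : R -> R) : right_bigO n F ->
  right_bigO n.+1 (fun h => h * F h).
Proof.
move=> [C C0 HF]; exists C => //; move: HF near_right01.
apply: filterS2 => h FC /andP[h0 _].
by rewrite normrM (gtr0_norm h0) exprS mulrCA ler_pM2l.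
Qed.

Let sumr_ord N C : \sum_(i < N) C = N%:R * C.
Proof. by rewrite sumr_const card_ord mulr_natl. Qed.

Lemma scaled_poly_bound N C h q c : 0 <= C -> 0 < h <= 1 ->
  scaled_poly N C h q -> c \in `[0, 1] -> `|q.[c]| <= N%:R * C.
Proof.
move=> C0 /andP[h0 h1] [sq cq]; rewrite in_itv/= => /andP[c0 c1].
rewrite (horner_coef_wide _ sq); apply: (le_trans (ler_norm_sum _ _ _)).
rewrite -sumr_ord; apply: ler_sum => i _; rewrite normrM normrX (ger0_norm c0).
have q1 : `|q`_i| <= C.
  by apply: (le_trans (cq i)); rewrite ler_piMr// exprn_ile1// ltW.
rewrite -[leRHS]mulr1.
by apply: ler_pM => //; [exact: exprn_ge0|exact: exprn_ile1].
Qed.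

Lemma scaled_polyM N1 N2 C1 C2 h q1 q2 : 0 < h -> 0 <= C1 -> 0 <= C2 ->
  scaled_poly N1 C1 h q1 -> scaled_poly N2 C2 h q2 ->
  scaled_poly (N1 + N2) ((N1 + N2)%:R * (C1 * C2)) h (q1 * q2).
Proof.
move=> h0 C10 C20 [s1 c1] [s2 c2].
have s12 : (size (q1 * q2)%R <= N1 + N2)%N.
  apply: (leq_trans (size_polyMleq _ _)); apply: (leq_trans (leq_pred _)).
  exact: leq_add.
split=> // l; have [lN|Nl] := ltnP l (N1 + N2)%N; last first.
  rewrite nth_default ?normr0; last exact: leq_trans s12 Nl.
  by rewrite !mulr_ge0// exprn_ge0// ltW.
rewrite coefM; apply: (le_trans (ler_norm_sum _ _ _)).
apply: (@le_trans _ _ (\sum_(j < l.+1) (C1 * C2 * h ^+ l))).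
  apply: ler_sum => j _; rewrite normrM.
  have -> : C1 * C2 * h ^+ l = (C1 * h ^+ j) * (C2 * h ^+ (l - j)).
    have jl : (j <= l)%N by rewrite -ltnS.
    by rewrite mulrACA -exprD subnKC.
  exact: ler_pM.
rewrite sumr_ord mulrA ler_wpM2r ?exprn_ge0 ?(ltW h0)//.
by rewrite ler_wpM2r ?mulr_ge0// ler_nat.
Qed.

(** Terms of degree i >= n have coefficients O(h^i), so dropping them costs O(h^n) on [0, 1]. Hence
    any fixed size N may be used in building an approximation. *)
Lemma approx_trunc n N C u : 0 <= C ->
  (\forall h \near 0^'+, exists2 q, scaled_poly N C h q &
    forall c, c \in `[0, 1] -> `|u h c - q.[c]| <= C * h ^+ n) ->
  approx n u.
Proof.
move=> C0 Hu; exists (C + (n + N)%:R * C); first by rewrite addr_ge0// mulr_ge0.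
move: Hu near_right01; apply: filterS2 => h [q [sq cq] uq] /andP[h0 h1].
exists (take_poly n q).
  split=> [|l]; first exact: size_take_poly.
  have CC : C * h ^+ l <= (C + (n + N)%:R * C) * h ^+ l.
    by rewrite ler_wpM2r ?exprn_ge0 ?(ltW h0)// lerDl mulr_ge0.
  rewrite coef_take_poly; case: ifP => _; first exact: le_trans CC.
  by rewrite normr0 (le_trans _ CC)// mulr_ge0// exprn_ge0// ltW.
move=> c cI; rewrite -(subrKA q.[c]) mulrDl.
apply: (le_trans (ler_normD _ _)); apply: lerD; first exact: uq.
have sq' : (size q <= n + N)%N by apply: (leq_trans sq); exact: leq_addl.
rewrite -hornerN -hornerD (@horner_coef_wide _ (n + N)); last first.
  apply: (leq_trans (size_polyD _ _)); rewrite geq_max sq' size_polyN.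
  by apply: (leq_trans (size_take_poly _ _)); exact: leq_addr.
apply: (le_trans (ler_norm_sum _ _ _)); rewrite -mulrA -sumr_ord.
apply: ler_sum => i _; move: cI; rewrite in_itv/= => /andP[c0 c1].
rewrite normrM normrX (ger0_norm c0) coefB coef_take_poly.
case: ifPn => [_|].
  by rewrite subrr normr0 mul0r mulr_ge0// exprn_ge0// ltW.
rewrite -leqNgt subr0 => ni; rewrite -[leRHS]mulr1.
apply: ler_pM => //; [exact: exprn_ge0| |exact: exprn_ile1].
by apply: (le_trans (cq _)); rewrite ler_wpM2l// ler_wiXn2l// ltW.
Qed.

Lemma approx_ext n u v :
  (\forall h \near 0^'+, forall c, c \in `[0, 1] -> u h c = v h c) ->
  approx n u -> approx n v.
Proof.
move=> uv [C C0 Hu]; exists C => //; move: uv Hu; apply: filterS2 => h uv.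
by move=> [q sq uq]; exists q => // c cI; rewrite -uv// uq.
Qed.

Lemma approx_bounded n u : approx n u ->
  exists2 C : R, 0 <= C & near_le01 (fun=> C) u.
Proof.
move=> [C C0 Hu]; exists (C + n%:R * C); first by rewrite addr_ge0// mulr_ge0.
move: Hu near_right01; apply: filterS2 => h [q sq uq] h01 c cI.
rewrite -(subrK q.[c] (u h c)); apply: (le_trans (ler_normD _ _)).
apply: lerD; last exact: (scaled_poly_bound _ h01).
have /andP[h0 h1] := h01.
by apply: (le_trans (uq c cI)); rewrite ler_piMr// exprn_ile1// ltW.
Qed.

(** Base case of the induction: for n = 0 the only polynomial allowed is 0. *)
Lemma bounded_approx0 C u : 0 <= C -> near_le01 (fun=> C) u -> approx 0 u.
Proof.
move=> C0 uC; exists C => //; move: uC near_right01; apply: filterS2 => h uC.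
move=> /andP[h0 _].
exists 0; last by move=> c cI; rewrite hornerC subr0 mulr1 uC.
by split=> [|l]; rewrite ?size_poly0// coef0 normr0 mulr_ge0// exprn_ge0// ltW.
Qed.

(** The constant polynomial has size 1, which is too large for n = 0; truncation covers that
    case. *)
Lemma approx_step n (a : R -> R) (C : R) : 0 <= C ->
  (\forall h \near 0^'+, `|a h| <= C) -> approx n (fun h _ => a h).
Proof.
move=> C0 aC; apply: (@approx_trunc _ 1 C) => //.
move: aC near_right01; apply: filterS2 => h aC /andP[h0 _].
exists (a h)%:P; last first.
  by move=> c _; rewrite hornerC subrr normr0 mulr_ge0// exprn_ge0// ltW.
split; first exact: size_polyC_leq1.
move=> [|l]; rewrite coefC/= ?expr0 ?mulr1// normr0.
by rewrite mulr_ge0// exprn_ge0// ltW.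
Qed.

Lemma approx_cst n (a : R) : approx n (fun _ _ => a).
Proof. by apply: (@approx_step _ _ `|a|) => //; exact: nearW. Qed.

Lemma approx_time n : approx n (fun h c => h * c).
Proof.
apply: (@approx_trunc _ 2 1) => //; move: near_right01.
apply: filterS => h /andP[h0 h1].
exists (h *: 'X); last first.
  move=> c _; rewrite hornerZ hornerX subrr normr0.
  by rewrite mulr_ge0// exprn_ge0// ltW.
split; first by rewrite (leq_trans (size_scale_leq _ _))// size_polyX.
move=> l; rewrite coefZ coefX mul1r.
case: eqP => [->|_]; first by rewrite mulr1 expr1 gtr0_norm.
by rewrite mulr0 normr0 exprn_ge0// ltW.
Qed.

Lemma approxD n u v : approx n u -> approx n v ->
  approx n (fun h c => u h c + v h c).
Proof.
move=> [C C0 Hu] [D D0 Hv]; exists (C + D); first exact: addr_ge0.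
move: Hu Hv near_right01; apply: filterS3 => h [p [sp cp] up] [q [sq cq] vq].
move=> /andP[h0 h1]; exists (p + q).
  split=> [|l]; first by rewrite (leq_trans (size_polyD _ _))// geq_max sp.
  by rewrite coefD mulrDl; apply: (le_trans (ler_normD _ _)); exact: lerD.
move=> c cI; rewrite hornerD opprD addrACA mulrDl.
by apply: (le_trans (ler_normD _ _)); apply: lerD; [exact: up|exact: vq].
Qed.

(** The product of the two approximating polynomials has the right scaling but size up to n + n, so
    it is truncated. *)
Lemma approxM n u v : approx n u -> approx n v ->
  approx n (fun h c => u h c * v h c).
Proof.
move=> au av; have [B B0 Bv] := approx_bounded av.
move: au av => [C C0 Hu] [D D0 Hv].
have nCD : 0 <= (n + n)%:R * (C * D) by rewrite !mulr_ge0.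
(* Split u v - p q as p (v - q) + (u - p) v: |p| <= n C and |v - q| <= D h^n give the first term, |u
   - p| <= C h^n and |v| <= B the second. *)
have E0 : 0 <= n%:R * C * D + C * B by rewrite addr_ge0// !mulr_ge0.
apply: (@approx_trunc n (n + n)
  ((n + n)%:R * (C * D) + (n%:R * C * D + C * B))).
  by rewrite addr_ge0.
have : \forall h \near 0^'+, 0 < h <= 1 /\
    forall c, c \in `[0, 1] -> `|v h c| <= B by
    apply: filterI => //; exact: near_right01.
move: Hu Hv; apply: filterS3 => h [p Sp up] [q Sq vq] [h01 vB].
have /andP[h0 h1] := h01; have hn k : 0 <= h ^+ k by rewrite exprn_ge0// ltW.
exists (p * q).
  have [s c] := scaled_polyM h0 C0 D0 Sp Sq; split=> // l.
  by apply: (le_trans (c l)); rewrite ler_wpM2r// lerDl.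
move=> c cI; rewrite hornerM.
have -> : u h c * v h c - p.[c] * q.[c] =
    p.[c] * (v h c - q.[c]) + (u h c - p.[c]) * v h c by ring.
apply: (le_trans (ler_normD _ _)); rewrite !normrM mulrDl.
apply: ler_wpDl; first exact: mulr_ge0.
rewrite mulrDl; apply: lerD.
  rewrite -mulrA; apply: ler_pM => //; last exact: vq.
  exact: (scaled_poly_bound _ h01).
by rewrite mulrAC; apply: ler_pM => //; [exact: up|exact: vB].
Qed.

Lemma approx_sum n (I : Type) (r : seq I) (u : I -> R -> R -> R) :
  (forall i, approx n (u i)) -> approx n (fun h c => \sum_(i <- r) u i h c).
Proof.
move=> au; elim: r => [|i r IHr].
  apply: (@approx_ext n (fun _ _ => 0)); last exact: approx_cst.
  by apply: nearW => h c _; rewrite big_nil.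
apply: approx_ext (approxD (au i) IHr).
by apply: nearW => h c _; rewrite big_cons.
Qed.

Lemma approxX n k u : approx n u -> approx n (fun h c => u h c ^+ k).
Proof.
move=> au; elim: k => [|k IHk].
  apply: (@approx_ext n (fun _ _ => 1)); last exact: approx_cst.
  by apply: nearW => h c _; rewrite expr0.
by apply: approx_ext (approxM au IHk); apply: nearW => h c _; rewrite exprS.
Qed.

(** The factor h in the derivative raises the order by one: integrating h q turns a coefficient
    O(h^j) of c^j into one O(h^(j+1)) of c^(j+1), and the error O(h^n) into O(h^(n+1)). *)
Lemma approx_primitive n u v (B : R) : approx n v -> 0 <= B ->
  (\forall h \near 0^'+, `|u h 0| <= B) ->
  (\forall h \near 0^'+, forall c, c \in `[0, 1] ->
    is_derive c (1 : R) (u h) (h * v h c)) ->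
  approx n.+1 u.
Proof.
move=> [C C0 Hv] B0 uB du; exists (B + C); first exact: addr_ge0.
have : \forall h \near 0^'+, 0 < h <= 1 /\ `|u h 0| <= B by
    apply: filterI => //; exact: near_right01.
move: Hv du; apply: filterS3 => h [q [sq cq] vq] du [/andP[h0 h1] uB'].
have hn k : 0 <= h ^+ k by rewrite exprn_ge0// ltW.
(* [Q] is the primitive of h q that agrees with [u h] at 0. *)
pose Q := \poly_(i < n.+1) (if i is j.+1 then h * q`_j / j.+1%:R else u h 0).
have dQ : Q^`() = h *: q.
  apply/polyP => i; rewrite coef_deriv coef_poly coefZ ltnS.
  case: ltnP => [_|ni]; first by rewrite -[LHS]mulr_natr divfK// pnatr_eq0.
  by rewrite mul0rn nth_default ?mulr0//; exact: leq_trans ni.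
have Q0 : Q.[0] = u h 0 by rewrite horner_coef0 coef_poly.
exists Q.
  split=> [|[|l]]; first exact: size_poly.
    by rewrite coef_poly/= mulr1 (le_trans uB')// lerDl.
  rewrite coef_poly; case: ifP => _; last by rewrite normr0 mulr_ge0 ?addr_ge0.
  rewrite !normrM (gtr0_norm h0) exprS mulrCA -mulrA ler_pM2l//.
  rewrite -[leRHS]mulr1; apply: ler_pM => //.
    by apply: (le_trans (cq l)); rewrite ler_wpM2r// lerDr.
  by rewrite ger0_norm ?invr_ge0// invf_le1 ?ltr0n// ler1n.
move=> c; rewrite in_itv/= => /andP[c0 c1].
(* [w] vanishes at 0 and has derivative h (v - q), so the mean value theorem bounds it by C
   h^(n+1). *)
pose w x := u h x - Q.[x].
have dw (x : R) : x \in `[0, 1] -> is_derive x (1 : R) w (h * (v h x - q.[x])).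
  move=> xI; have du' := du x xI; rewrite mulrBr -hornerZ -dQ.
  exact: is_deriveB.
have d0 (x : R) : x \in `]0, c[ -> is_derive x (1 : R) w (h * (v h x - q.[x])).
  rewrite in_itv/= => /andP[x0 xc]; apply: dw.
  by rewrite in_itv/= (ltW x0) (le_trans (ltW xc)).
have cw : {within `[0, c], continuous w}.
  apply: continuous_subspace_itv => x /[!in_itv]/= /andP[x0 xc].
  apply: differentiable_continuous; apply/derivable1_diffP.
  by have [|//] := dw x; rewrite in_itv/= x0 (le_trans xc).
have [x xI] := MVT_segment c0 d0 cw.
have xI01 : x \in `[0, 1].
  by move: xI; rewrite !in_itv/= => /andP[-> xc]; exact: le_trans c1.
rewrite {1 2}/w Q0 subrr !subr0 => ->.
rewrite normrM normrM (gtr0_norm h0) (ger0_norm c0) exprS mulrCA -mulrA.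
rewrite ler_pM2l// -[leRHS]mulr1; apply: ler_pM => //.
by apply: (le_trans (vq x xI01)); rewrite ler_wpM2r// lerDr.
Qed.

End uniform_approximation.

(** * Projection of approximable functions *)

Section projection_of_approximable.
Context {R : realType} (P : nat -> {poly R}).
Hypothesis P_legendre : orthonormal_legendre P.
Implicit Types (a u : R -> R -> R).

(** Since n <= s, Pi fixes q, so Pi u - q = Pi (u - q) and the sup-norm bound on Pi applies. That
    bound is a premise so that D is chosen before h. *)
Lemma lproj_near n s u (C h : R) (q : {poly R}) (D : R) : (n <= s)%N ->
  (forall (f : R -> R) (M : R), cont01 f ->
    (forall c, c \in `[0, 1] -> `|f c| <= M) ->
    forall c, c \in `[0, 1] -> `|(lproj P s f).[c]| <= D * M) ->
  cont01 (u h) -> scaled_poly n C h q ->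
  (forall c, c \in `[0, 1] -> `|u h c - q.[c]| <= C * h ^+ n) ->
  forall c, c \in `[0, 1] ->
    `|(lproj P s (u h)).[c] - q.[c]| <= D * C * h ^+ n.
Proof.
move=> ns HD cu [sq _] uq c cI; rewrite -mulrA.
rewrite -{1}(lproj_horner P_legendre (leq_trans sq ns)) -hornerN -hornerD.
rewrite -lprojB//; last exact: cont01_horner.
by apply: HD => //; apply: cont01B => //; exact: cont01_horner.
Qed.

Lemma approx_lproj n s u : (n <= s)%N -> approx n u ->
  (\forall h \near 0^'+, cont01 (u h)) ->
  approx n (fun h c => (lproj P s (u h)).[c]).
Proof.
move=> ns [C C0 Hu] cu; have [D D0 HD] := lproj_bounded P s.
exists (C + D * C); first by rewrite addr_ge0// mulr_ge0.
move: Hu cu (@near_right01 R); apply: filterS3 => h [q Sq uq] cu /andP[h0 _].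
have hn k : 0 <= h ^+ k by rewrite exprn_ge0// ltW.
exists q.
  case: Sq => sq cq; split=> // l; apply: (le_trans (cq l)).
  by rewrite ler_wpM2r// lerDl mulr_ge0.
move=> c cI; apply: (le_trans (lproj_near ns HD cu Sq uq cI)).
by rewrite ler_wpM2r// lerDr.
Qed.

Lemma approx_lproj_error s u : approx s u ->
  (\forall h \near 0^'+, cont01 (u h)) ->
  exists2 C : R, 0 <= C & near_le01 (fun h => C * h ^+ s)
    (fun h c => (lproj P s (u h)).[c] - u h c).
Proof.
move=> [C C0 Hu] cu; have [D D0 HD] := lproj_bounded P s.
exists (D * C + C); first by rewrite addr_ge0// mulr_ge0.
move: Hu cu; apply: filterS2 => h [q Sq uq] cu c cI.
rewrite -(subrKA q.[c]) mulrDl; apply: (le_trans (ler_normD _ _)).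
apply: lerD; first exact: (lproj_near (leqnn s) HD cu Sq uq).
by rewrite distrC uq.
Qed.

(* Up to O(h^s), the factor a is a polynomial of degree < s, to which the
   projection error is orthogonal. *)
Lemma int01_lproj_error s a u : approx s a -> approx s u ->
  (\forall h \near 0^'+, cont01 (a h)) ->
  (\forall h \near 0^'+, cont01 (u h)) ->
  right_bigO (2 * s)
    (fun h => int01 (fun c => a h c * ((lproj P s (u h)).[c] - u h c))).
Proof.
move=> [C C0 Ha] au ca cu; have [D D0 HD] := approx_lproj_error au cu.
exists (C * D); first exact: mulr_ge0.
have : \forall h \near 0^'+, cont01 (a h) /\ cont01 (u h).
  by apply: filterI.
move: Ha HD; apply: filterS3 => h [p [sp _] ap] uD [ca' cu'].
set e := fun c => (lproj P s (u h)).[c] - u h c.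
have ce : cont01 e by apply: cont01B => //; exact: cont01_horner.
have cp : cont01 (horner p) by exact: cont01_horner.
have -> : int01 (fun c => a h c * e c) = int01 (fun c => (a h c - p.[c]) * e c).
  rewrite -[LHS]subr0 -(int01_lproj_orthogonal P_legendre cu' sp) -int01B.
  - by apply: eq_int01 => c _; rewrite mulrBl.
  - exact: cont01M.
  - exact: cont01M.
apply: normr_int01_le => [|c cI]; first by apply: cont01M => //; exact: cont01B.
rewrite normrM mul2n -addnn exprD mulrACA; apply: ler_pM => //.
  exact: ap.
exact: uD.
Qed.

End projection_of_approximable.

(** * Calculus of functions of class C^k on an open set *)

Section smooth_functions.
Context {R : realType} {V : normedModType R}.

(** The first-order expansion of f at x only involves values near x, so it is one of g as well;
    uniqueness of the differential concludes. *)
Lemma near_eq_differentiable (W : normedModType R) (f g : V -> W) x :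
  (\forall z \near x, f z = g z) -> differentiable f x -> differentiable g x.
Proof.
move=> fg df; have gE : g \o shift x = cst (g x) + 'd f x +o_ 0 id.
  apply/eqaddoP => e e0; have /diff_locally/eqaddoP/(_ e e0) := df.
  have : \forall z \near (0 : V), f (z + x) = g (z + x).
    by move: fg; rewrite (near_shift 0) /= subr0.
  apply: filterS2 => z fgz.
  have fgx := nbhs_singleton fg.
  by rewrite !fctE /= -fgz -fgx.
have dg := diff_unique (diff_continuous df) gE.
by apply/diff_locallyP; rewrite dg; split => //; exact: diff_continuous.
Qed.

Variable U : set V.
Hypothesis U_open : open U.

Let near_U (W : normedModType R) (f g : V -> W) x :
  (forall x, U x -> f x = g x) -> U x -> \forall z \near x, f z = g z.
Proof. by move=> fg Ux; apply: filterS (open_nbhs_nbhs (conj U_open Ux)). Qed.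

(** Since U is open, equality on U is equality near each of its points, which derivatives
    respect. *)
Lemma is_Ck_ext (W : normedModType R) k (f g : V -> W) :
  (forall x, U x -> f x = g x) -> is_Ck k U f -> is_Ck k U g.
Proof.
elim: k f g => [|k IHk] f g fg /=.
  move=> cf x Ux; rewrite /prop_for /continuous_at -(fg x Ux).
  by apply: cvg_trans (cf x Ux); apply: near_eq_cvg; exact: near_U.
move=> [df dDf]; split=> [x Ux|v].
  by apply: near_eq_differentiable (df x Ux); exact: near_U.
by apply: IHk (dDf v) => x Ux; apply: near_eq_derive; exact: near_U.
Qed.

Lemma is_Ck_pred (W : normedModType R) k (f : V -> W) :
  is_Ck k.+1 U f -> is_Ck k U f.
Proof.
elim: k f => [|k IHk] f [df dDf].
  by move=> x Ux; apply: differentiable_continuous; exact: df.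
by split=> // v; apply: IHk; exact: dDf.
Qed.

Lemma is_Ck_cst (W : normedModType R) k (a : W) : is_Ck k U (fun=> a).
Proof.
elim: k a => [|k IHk] a; first by move=> x _; exact: cst_continuous.
split=> [x _|v]; first exact: differentiable_cst.
by apply: is_Ck_ext (IHk 0) => x _; rewrite derive_cst.
Qed.

Lemma is_CkD (W : normedModType R) k (f g : V -> W) :
  is_Ck k U f -> is_Ck k U g -> is_Ck k U (f \+ g).
Proof.
elim: k f g => [|k IHk] f g.
  by move=> cf cg x Ux; apply: cvgD; [exact: cf|exact: cg].
move=> [df dDf] [dg dDg]; split=> [x Ux|v].
  by apply: differentiableD; [exact: df|exact: dg].
apply: is_Ck_ext (IHk _ _ (dDf v) (dDg v)) => x Ux.
by rewrite deriveD//; apply: diff_derivable; [exact: df|exact: dg].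
Qed.

Lemma is_CkM k (f g : V -> R) :
  is_Ck k U f -> is_Ck k U g -> is_Ck k U (f \* g).
Proof.
elim: k f g => [|k IHk] f g.
  by move=> cf cg x Ux; apply: cvgM; [exact: cf|exact: cg].
move=> Cf Cg; have [df dDf] := Cf; have [dg dDg] := Cg; split=> [x Ux|v].
  by apply: differentiableM; [exact: df|exact: dg].
(* The product rule also involves f and g undifferentiated, one order of smoothness lower. *)
have Cf' := is_Ck_pred Cf; have Cg' := is_Ck_pred Cg.
apply: is_Ck_ext (is_CkD (IHk _ _ Cf' (dDg v)) (IHk _ _ Cg' (dDf v))) => x Ux.
by rewrite deriveM//; apply: diff_derivable; [exact: df|exact: dg].
Qed.

Lemma is_smoothM (f g : V -> R) : is_smooth U f -> is_smooth U g ->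
  is_smooth U (fun x => f x * g x).
Proof. by move=> sf sg k; exact: is_CkM. Qed.

Lemma is_smooth_sum (I : Type) (r : seq I) (f : I -> V -> R) :
  (forall i, is_smooth U (f i)) -> is_smooth U (fun x => \sum_(i <- r) f i x).
Proof.
move=> sf k; elim: r => [|i r IHr].
  by apply: (is_Ck_ext (f := fun=> 0)) (is_Ck_cst _ _) => x _; rewrite big_nil.
by apply: is_Ck_ext (is_CkD (sf i k) IHr) => x _; rewrite big_cons.
Qed.

Lemma is_smooth_derive (f : V -> R) v : is_smooth U f -> is_smooth U ('D_v f).
Proof. by move=> sf k; have [_] := sf k.+1; exact. Qed.

Lemma is_smooth_continuous (f : V -> R) x : is_smooth U f -> U x ->
  {for x, continuous f}.
Proof. by move=> /(_ 0%N); apply. Qed.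

Lemma is_smooth_differentiable (f : V -> R) x : is_smooth U f -> U x ->
  differentiable f x.
Proof. by move=> /(_ 1%N)[df _]; exact: df. Qed.

Lemma is_Ck_entry m n k (M : V -> 'M[R]_(m, n)) i j :
  is_Ck k U M -> is_Ck k U (fun x => M x i j).
Proof.
elim: k M => [|k IHk] M.
  move=> cM x Ux.
  apply: (@continuous_comp _ _ _ M (fun A : 'M[R]_(m, n) => A i j)).
    exact: cM.
  exact: coord_continuous.
move=> [dM dDM]; split=> [x Ux|v].
  apply: (@differentiable_comp _ _ _ _ M (fun A : 'M[R]_(m, n) => A i j)).
    exact: dM.
  exact: differentiable_coord.
apply: is_Ck_ext (IHk _ (dDM v)) => x Ux.
by rewrite derive_mx ?mxE//; apply: diff_derivable; exact: dM.
Qed.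

Lemma is_smooth_entry m n (M : V -> 'M[R]_(m, n)) i j :
  is_smooth U M -> is_smooth U (fun x => M x i j).
Proof. by move=> sM k; exact: is_Ck_entry. Qed.

End smooth_functions.

(** * Coordinates, bounds on compact sets, and the chain rule along a path *)

Section coordinates.
Context {R : realType} {m : nat}.
Implicit Types (g : 'cV[R]_m -> R).

Lemma is_smooth_coord (U : set 'cV[R]_m) k : open U ->
  is_smooth U (fun x : 'cV[R]_m => x k 0).
Proof.
move=> U_open [|n]; first by move=> x _; exact: coord_continuous.
split=> [x _|v]; first exact: differentiable_coord.
apply: (is_Ck_ext U_open) (is_Ck_cst U_open n (v k 0)) => x _.
have idE : 'D_v (fun x : 'cV[R]_m => x) x = v by exact: derive_id.
rewrite -[in LHS]idE derive_mx ?mxE//; exact: derivable_id.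
Qed.

Lemma continuous_compact_bounded (V : normedModType R) (K U : set V)
    (g : V -> R) : compact K -> K `<=` U ->
  (forall x, U x -> {for x, continuous g}) ->
  exists2 C : R, 0 <= C & forall x, K x -> `|g x| <= C.
Proof.
move=> cK KU cg.
have /compact_bounded[M [Mr HM]] : compact (g @` K).
  apply: continuous_compact => //; apply: continuous_in_subspaceT => x.
  by rewrite inE => /KU /cg.
exists (`|M| + 1); first by rewrite addr_ge0.
move=> x Kx; apply: (HM (`|M| + 1)); last by exists x.
by rewrite (le_lt_trans (ler_norm _))// ltrDl.
Qed.

(** Chain rule in coordinates: the differential of g is linear, so decomposing v in the standard
    basis yields the partial derivatives. *)
Lemma is_derive_path g (x : R -> 'cV[R]_m) (c : R) (v : 'cV[R]_m) :
  differentiable g (x c) ->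
  (forall k, is_derive c (1 : R) (fun t => x t k 0) (v k 0)) ->
  is_derive c (1 : R) (fun t => g (x t))
    (\sum_k 'D_(delta_mx k 0) g (x c) * v k 0).
Proof.
move=> dg dx.
have dxc : derivable x c 1.
  by apply/derivable_mxP => i j; rewrite (ord1 j); have [] := dx i.
have xv : 'D_1 x c = v.
  rewrite derive_mx//; apply/matrixP => i j; rewrite mxE (ord1 j).
  by have [_ ->] := dx i.
have dx' : differentiable x c by apply/derivable1_diffP.
have dgx : differentiable (g \o x) c by exact: differentiable_comp.
apply: DeriveDef; first exact: diff_derivable.
rewrite [LHS](deriveE _ dgx) diff_comp//= -[X in 'd g _ X]deriveE// xv.
rewrite {1}(matrix_sum_delta v) linear_sum; apply: eq_bigr => k _.
by rewrite big_ord1 linearZ/= deriveE// mulrC.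
Qed.

End coordinates.

(** * Lie derivatives and the Taylor polynomial of the flow *)

Section flow_expansion.
Context {R : realType} {m : nat}.
Variables (S : 'cV[R]_m -> 'M[R]_m) (G : 'cV[R]_m -> 'cV[R]_m).
Variable U : set 'cV[R]_m.
Hypothesis U_open : open U.
Hypothesis S_smooth : is_smooth U S.
Hypothesis G_smooth : is_smooth U G.
Implicit Types (h c : R) (g : 'cV[R]_m -> R) (x : 'cV[R]_m) (k : 'I_m).

(** The k-th component of f = S grad H, with [G] standing for the gradient. *)
Definition field k x := \sum_l S x k l * G x l 0.

Definition lie_derive g x := \sum_k 'D_(delta_mx k 0) g x * field k x.

Definition lie n k : 'cV[R]_m -> R := iter n lie_derive (fun x => x k 0).

Definition time_poly h n : {poly R} :=
  (h ^+ n / n`!%:R) *: (1 - 'X) ^+ n.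

(* Taylor expansion, in the remaining time h (1 - c), of the k-th coordinate of
   the flow started at x. *)
Definition flow_taylor N h k c x :=
  \sum_(n < N.+1) (time_poly h n).[c] * lie n k x.

(** The partial derivative of [flow_taylor] in the j-th coordinate of x, that is, the weight B_j of
    the defect. *)
Definition flow_taylor_diff N h k j c x :=
  \sum_(n < N.+1) (time_poly h n).[c] * 'D_(delta_mx j 0) (lie n k) x.

Lemma field_smooth k : is_smooth U (field k).
Proof.
apply: is_smooth_sum => // l.
by apply: is_smoothM => //; exact: is_smooth_entry.
Qed.

Lemma lie_smooth n k : is_smooth U (lie n k).
Proof.
elim: n => [|n IHn]; first exact: is_smooth_coord.
apply: is_smooth_sum => // j; apply: is_smoothM => //; last exact: field_smooth.
exact: is_smooth_derive.
Qed.

Lemma deriv_time_poly0 h : (time_poly h 0)^`() = 0.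
Proof. by rewrite /time_poly expr0 derivZ derivC scaler0. Qed.

Lemma deriv_time_poly h n : (time_poly h n.+1)^`() = - h *: time_poly h n.
Proof.
rewrite /time_poly derivZ deriv_exp derivB derivX derivC sub0r mulN1r.
rewrite mulNrn scalerN -scalerMnr scalerMnl -scaleNr scalerA; congr (_ *: _).
rewrite factS natrM exprS -mulr_natr.
have n0 : n.+1%:R != 0 :> R by rewrite pnatr_eq0.
have f0 : n`!%:R != 0 :> R by rewrite pnatr_eq0 -lt0n fact_gt0.
by move: n.+1%:R n`!%:R n0 f0 => a b a0 b0; field; rewrite a0 b0.
Qed.

Lemma time_poly_le h n c : 0 < h -> c \in `[0, 1] ->
  `|(time_poly h n).[c]| <= h ^+ n.
Proof.
rewrite in_itv/= => h0 /andP[c0 c1].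
rewrite hornerZ horner_exp !hornerE normrM -[leRHS]mulr1.
have hn : 0 <= h ^+ n by rewrite exprn_ge0// ltW.
apply: ler_pM => //.
  rewrite normrM (ger0_norm hn) ler_piMr// ger0_norm ?invr_ge0//.
  by rewrite invf_le1 ?ltr0n ?fact_gt0// ler1n fact_gt0.
by rewrite normrX ger0_norm ?subr_ge0// exprn_ile1 ?subr_ge0// lerBlDr lerDl.
Qed.

Lemma flow_taylor1 N h k x : flow_taylor N h k 1 x = x k 0.
Proof.
rewrite /flow_taylor big_ord_recl/= big1 ?addr0.
  by rewrite /time_poly !expr0 fact0 divr1 scale1r hornerC mul1r.
move=> n _; rewrite hornerZ horner_exp !hornerE subrr.
by rewrite expr0n mulr0 mul0r.
Qed.

(** With x' = h v and v = f + (v - f), the contribution of f to term n cancels the derivative of the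
    time weight in term n + 1. The sum telescopes to its top term plus the weighted defect v - f. *)
Lemma is_derive_flow_taylor N h k c (x : R -> 'cV[R]_m) (v : 'I_m -> R) :
  U (x c) ->
  (forall j, is_derive c (1 : R) (fun t => x t j 0) (h * v j)) ->
  is_derive c (1 : R) (fun t => flow_taylor N h k t (x t))
    (h * ((time_poly h N).[c] * lie N.+1 k (x c) +
      \sum_j flow_taylor_diff N h k j c (x c) * (v j - field j (x c)))).
Proof.
move=> Uxc dx.
(* The part of the derivative coming from f is the next iterated Lie derivative. *)
have dlie n : is_derive c (1 : R) (fun t => lie n k (x t))
    (h * (\sum_j 'D_(delta_mx j 0) (lie n k) (x c) * (v j - field j (x c)) +
      lie n.+1 k (x c))).
  have dlx : differentiable (lie n k) (x c).
    by apply: is_smooth_differentiable Uxc; exact: lie_smooth.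
  have dx' j : is_derive c (1 : R) (fun t => x t j 0) ((\col_j (h * v j)) j 0).
    by rewrite mxE.
  apply: (is_derive_eq (is_derive_path dlx dx')).
  rewrite /= /lie_derive -big_split/= mulr_sumr; apply: eq_bigr => j _.
  by rewrite mxE -mulrDr subrK mulrCA.
have dterm n : is_derive c (1 : R)
    (fun t => (time_poly h n).[t] * lie n k (x t))
    ((time_poly h n).[c] * (h * (\sum_j 'D_(delta_mx j 0) (lie n k) (x c) *
      (v j - field j (x c)) + lie n.+1 k (x c))) +
     lie n k (x c) * (time_poly h n)^`().[c]).
  exact: is_deriveM.
(* The induction performs the telescoping: differentiating the new time weight gives -h
   [time_poly h N], which cancels the previous top term. *)
elim: N => [|N IHN].
  have -> : (fun t => flow_taylor 0 h k t (x t)) =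
      (fun t => (time_poly h 0).[t] * lie 0 k (x t)).
    by apply/funext => t; rewrite /flow_taylor big_ord1.
  apply: (is_derive_eq (dterm 0%N)).
  rewrite deriv_time_poly0 horner0 mulr0 addr0 mulrCA addrC mulrDr.
  congr (_ * (_ + _)).
  rewrite mulr_sumr; apply: eq_bigr => j _.
  by rewrite /flow_taylor_diff big_ord1 mulrA.
have -> : (fun t => flow_taylor N.+1 h k t (x t)) =
    (fun t => flow_taylor N h k t (x t) +
              (time_poly h N.+1).[t] * lie N.+1 k (x t)).
  by apply/funext => t; rewrite /flow_taylor big_ord_recr.
apply: (is_derive_eq (is_deriveD IHN (dterm N.+1))).
rewrite deriv_time_poly (hornerZ (- h)).
have -> : \sum_j flow_taylor_diff N.+1 h k j c (x c) * (v j - field j (x c)) =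
    \sum_j flow_taylor_diff N h k j c (x c) * (v j - field j (x c)) +
    (time_poly h N.+1).[c] * \sum_j 'D_(delta_mx j 0) (lie N.+1 k) (x c) *
      (v j - field j (x c)).
  rewrite mulr_sumr -big_split; apply: eq_bigr => j _ /=.
  by rewrite /flow_taylor_diff [in LHS]big_ord_recr/= mulrDl mulrA.
ring.
Qed.

End flow_expansion.

(** * The numerical path against the Taylor polynomial of the flow *)

Section line_integral_method.
Context {R : realType} {m : nat}.
Variables (S : 'cV[R]_m -> 'M[R]_m) (G : 'cV[R]_m -> 'cV[R]_m).
Variables (U K : set 'cV[R]_m) (y0 : 'cV[R]_m).
Hypothesis U_open : open U.
Hypothesis S_smooth : is_smooth U S.
Hypothesis G_smooth : is_smooth U G.
Hypothesis K_compact : compact K.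
Hypothesis K_sub : K `<=` U.
Variables (P : nat -> {poly R}) (s : nat).
Hypothesis P_legendre : orthonormal_legendre P.
Variable x : R -> R -> 'cV[R]_m.
Implicit Types (h c : R) (g : 'cV[R]_m -> R) (k : 'I_m).

(** The field S Pi G along the path, where [x h c] stands for sigma(c h). A second projection gives
    the velocity of the method, as in the hypothesis [dx]. *)
Definition projected_field k h c :=
  \sum_l S (x h c) k l * (lproj P s (fun t => G (x h t) l 0)).[c].

Hypothesis x0 : \forall h \near 0^'+, x h 0 = y0.
Hypothesis xK : \forall h \near 0^'+, forall c, c \in `[0, 1] -> K (x h c).
Hypothesis dx : \forall h \near 0^'+, forall c, c \in `[0, 1] -> forall k,
  is_derive c (1 : R) (fun t => x h t k 0)
    (h * (lproj P s (projected_field k h)).[c]).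

Let path_derive g h c : is_smooth U g -> K (x h c) ->
  (forall k, is_derive c (1 : R) (fun t => x h t k 0)
    (h * (lproj P s (projected_field k h)).[c])) ->
  is_derive c (1 : R) (fun t => g (x h t))
    (h * \sum_k 'D_(delta_mx k 0) g (x h c) *
                (lproj P s (projected_field k h)).[c]).
Proof.
move=> sg Kx dxc; have dg : differentiable g (x h c).
  by apply: is_smooth_differentiable sg _; exact: K_sub.
have dx' j : is_derive c (1 : R) (fun t => x h t j 0)
    ((\col_j (h * (lproj P s (projected_field j h)).[c])) j 0).
  by rewrite mxE.
apply: (is_derive_eq (is_derive_path dg dx')).
by rewrite mulr_sumr; apply: eq_bigr => k _; rewrite mxE mulrCA.
Qed.

Let near_cont g : is_smooth U g ->
  \forall h \near 0^'+, cont01 (fun c => g (x h c)).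
Proof.
move=> sg; move: xK dx; apply: filterS2 => h xKh dxh c cI.
apply: differentiable_continuous; apply/derivable1_diffP.
by have [] := path_derive sg (xKh c cI) (dxh c cI).
Qed.

Let near_cont_all (g : 'I_m -> 'cV[R]_m -> R) : (forall k, is_smooth U (g k)) ->
  \forall h \near 0^'+, forall k, cont01 (fun c => g k (x h c)).
Proof. by move=> sg; apply: filter_forall => k; exact: near_cont. Qed.

Let S_entry k l : is_smooth U (fun x => S x k l).
Proof. exact: is_smooth_entry. Qed.

Let G_entry l : is_smooth U (fun x => G x l 0).
Proof. exact: is_smooth_entry. Qed.

Let projected_field_cont k : \forall h \near 0^'+, cont01 (projected_field k h).
Proof.
move: (near_cont_all (S_entry k)); apply: filterS => h cS.
by apply: cont01_sum => l; apply: cont01M => //; exact: cont01_horner.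
Qed.

Let projected_field_approx n k : (n <= s)%N ->
  (forall g, is_smooth U g -> approx n (fun h c => g (x h c))) ->
  approx n (projected_field k).
Proof.
move=> ns Hn; apply: approx_sum => l; apply: approxM.
  exact: Hn (S_entry k l).
apply: (approx_lproj P_legendre ns (u := fun h c => G (x h c) l 0)).
  exact: Hn (G_entry l).
exact: near_cont (G_entry l).
Qed.

(** Boundedness on K starts the induction. In the step, the derivative of g along the path is h
    times a combination of smooth functions of the path and projections, approximable to order n,
    and integration gains one order. The bound n <= s lets Pi keep the approximating polynomials. *)
Lemma approx_smooth_path n g : (n <= s)%N -> is_smooth U g ->
  approx n (fun h c => g (x h c)).
Proof.
elim: n g => [|n IHn] g ns sg.
  have [C C0 gC] : exists2 C : R, 0 <= C & forall x, K x -> `|g x| <= C.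
    apply: (continuous_compact_bounded K_compact K_sub) => z Uz.
    exact: is_smooth_continuous Uz.
  apply: (bounded_approx0 C0); move: xK; apply: filterS => h xKh c cI.
  by apply: gC; exact: xKh.
have Hn f : is_smooth U f -> approx n (fun h c => f (x h c)).
  by apply: IHn; exact: ltnW.
apply: (@approx_primitive _ n _ (fun h c => \sum_k 'D_(delta_mx k 0) g (x h c) *
    (lproj P s (projected_field k h)).[c]) `|g y0|) => //.
- apply: approx_sum => k; apply: approxM.
    exact: Hn (is_smooth_derive _ sg).
  apply: approx_lproj => //; first exact: ltnW.
  by apply: projected_field_approx => //; exact: ltnW.
- by move: x0; apply: filterS => h ->.
- move: xK dx; apply: filterS2 => h xKh dxh c cI.
  by apply: path_derive => //; [exact: xKh|exact: dxh].
Qed.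

(** The defect Pi W - f with W = S Pi G splits into the outer error Pi W - W and the inner error S
    (Pi G - G); orthogonality makes the integral of each, weighted by B_j, of order h^(2s). *)
Lemma local_error_approximation k :
  right_bigO (2 * s).+1
    (fun h => x h 1 k 0 - flow_taylor S G (2 * s) h k 0 y0).
Proof.
pose N := (2 * s)%N.
pose B j h c := flow_taylor_diff S G N h k j c (x h c).
have sLie := lie_smooth U_open S_smooth G_smooth.
have B_approx j : approx s (B j).
  apply: approx_sum => n; apply: approxM.
    (* The time weight is rewritten through h and h c, so that the closure rules for sums, products
       and powers apply. *)
    have Ha : approx s (fun h c => n`!%:R^-1 * (h * 1 - h * c) ^+ n).
      apply: approxM; first exact: approx_cst.
      apply: approxX; apply: approxD.
        apply: (@approx_step _ _ _ 1) => //; move: (@near_right01 R).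
        by apply: filterS => h /andP[h0 h1]; rewrite mulr1 gtr0_norm.
      apply: approx_ext (approxM (approx_cst _ (-1)) (approx_time _)).
      by apply: nearW => h c _; rewrite mulN1r.
    apply: approx_ext Ha; apply: nearW => h c _.
    have -> : h * 1 - h * c = h * (1 - c) by ring.
    rewrite exprMn /time_poly hornerZ horner_exp hornerD hornerN hornerX.
    by rewrite hornerC; ring.
  exact: approx_smooth_path (leqnn s) (is_smooth_derive _ (sLie n k)).
have B_cont : \forall h \near 0^'+, forall j, cont01 (B j h).
  apply: filter_forall => j.
  have : \forall h \near 0^'+, forall n : 'I_N.+1,
      cont01 (fun c => 'D_(delta_mx j 0) (lie S G n k) (x h c)).
    apply: filter_forall => n.
    exact: near_cont (is_smooth_derive _ (sLie n k)).
  apply: filterS => h cD; apply: cont01_sum => n.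
  by apply: cont01M => //; exact: cont01_horner.
have S_cont : \forall h \near 0^'+, forall j l, cont01 (fun c => S (x h c) j l).
  by apply: filter_forall => j; exact: near_cont_all (S_entry j).
have G_cont : \forall h \near 0^'+, forall l, cont01 (fun c => G (x h c) l 0).
  exact: near_cont_all G_entry.
have W_cont : \forall h \near 0^'+, forall j, cont01 (projected_field j h).
  by apply: filter_forall.
have [M M0 lieM] : exists2 M : R, 0 <= M &
    forall x, K x -> `|lie S G N.+1 k x| <= M.
  apply: (continuous_compact_bounded K_compact K_sub) => z Uz.
  exact: is_smooth_continuous Uz.
(* [E0] is the top Taylor term, [E1] the outer and [E2] the inner projection error; in [E2] the
   entry of S joins the weight. *)
pose E0 h := int01 (fun c => (time_poly h N).[c] * lie S G N.+1 k (x h c)).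
pose E1 j h := int01 (fun c => B j h c *
  ((lproj P s (projected_field j h)).[c] - projected_field j h c)).
pose E2 j l h := int01 (fun c => B j h c * S (x h c) j l *
  ((lproj P s (fun t => G (x h t) l 0)).[c] - G (x h c) l 0)).
have L_cont : \forall h \near 0^'+, cont01 (fun c => lie S G N.+1 k (x h c)).
  exact: near_cont (sLie _ _).
have HE0 : right_bigO N E0.
  exists M => //; move: xK L_cont (@near_right01 R).
  apply: filterS3 => h xKh cL /andP[h0 _]; apply: normr_int01_le => [|c cI].
    by apply: cont01M => //; exact: cont01_horner.
  rewrite normrM mulrC; apply: ler_pM => //; first exact/lieM/xKh.
  exact: time_poly_le.
have HE1 j : right_bigO N (E1 j).
  apply: (int01_lproj_error P_legendre (a := B j) (u := projected_field j)).
  - exact: B_approx.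
  - by apply: projected_field_approx => // g; exact: approx_smooth_path.
  - by move: B_cont; apply: filterS => h; exact.
  - exact: projected_field_cont.
have HE2 j l : right_bigO N (E2 j l).
  apply: (int01_lproj_error P_legendre (a := fun h c => B j h c * S (x h c) j l)
    (u := fun h c => G (x h c) l 0)).
  - by apply: approxM => //; exact: approx_smooth_path (leqnn s) (S_entry j l).
  - exact: approx_smooth_path (leqnn s) (G_entry l).
  - by move: B_cont S_cont; apply: filterS2 => h cB cS; exact: cont01M.
  - by move: G_cont; apply: filterS => h; exact.
have HE : right_bigO N.+1
    (fun h => h * (E0 h + \sum_j (E1 j h + \sum_l E2 j l h))).
  apply: right_bigO_mulh; apply: right_bigOD => //; apply: right_bigO_sum => j.
  by apply: right_bigOD => //; exact: right_bigO_sum.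
(* The estimates are done; what remains is an exact identity for each small h. *)
apply: right_bigO_ext HE.
near=> h.
have h_cB : forall j, cont01 (B j h) by near: h.
have h_cS : forall j l, cont01 (fun c => S (x h c) j l) by near: h.
have h_cG : forall l, cont01 (fun c => G (x h c) l 0) by near: h.
have h_cW : forall j, cont01 (projected_field j h) by near: h.
have h_cL : cont01 (fun c => lie S G N.+1 k (x h c)) by near: h.
have h_x0 : x h 0 = y0 by near: h.
have h_xK : forall c, c \in `[0, 1] -> K (x h c) by near: h.
have h_dx : forall c, c \in `[0, 1] -> forall k,
  is_derive c (1 : R) (fun t => x h t k 0)
    (h * (lproj P s (projected_field k h)).[c]) by near: h.
(* The remaining time vanishes at c = 1, so x(1) is the Taylor polynomial there and the error
   becomes phi(1) - phi(0). *)
rewrite -[in RHS]h_x0 -(flow_taylor1 S G N h k (x h 1)).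
pose V j c := (lproj P s (projected_field j h)).[c] - field S G j (x h c).
pose D c := (time_poly h N).[c] * lie S G N.+1 k (x h c) +
  \sum_j B j h c * V j c.
have cF j : cont01 (fun c => field S G j (x h c)).
  by apply: cont01_sum => l; exact: cont01M.
have cV j : cont01 (V j) by apply: cont01B => //; exact: cont01_horner.
have cT : cont01 (fun c => (time_poly h N).[c] * lie S G N.+1 k (x h c)).
  by apply: cont01M => //; exact: cont01_horner.
have cBV j : cont01 (fun c => B j h c * V j c) by exact: cont01M.
have cD : cont01 D by apply: cont01D => //; exact: cont01_sum.
have -> : flow_taylor S G N h k 1 (x h 1) - flow_taylor S G N h k 0 (x h 0) =
    int01 (fun c => h * D c).
  symmetry; apply: (@int01_derive _ (fun t => flow_taylor S G N h k t (x h t))).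
    by apply: cont01M => //; exact: cont01_cst.
  move=> c cI; apply: (is_derive_flow_taylor U_open S_smooth G_smooth).
    exact/K_sub/h_xK.
  by move=> j; exact: h_dx.
rewrite int01Zl//; congr (_ * _).
rewrite int01D//; last exact: cont01_sum.
congr (_ + _); rewrite int01_sum//; apply: eq_bigr => j _.
have cE1 : cont01 (fun c =>
    (lproj P s (projected_field j h)).[c] - projected_field j h c).
  by apply: cont01B => //; exact: cont01_horner.
have cE2 l : cont01 (fun c =>
    (lproj P s (fun t => G (x h t) l 0)).[c] - G (x h c) l 0).
  by apply: cont01B => //; exact: cont01_horner.
have cBS l : cont01 (fun c => B j h c * S (x h c) j l) by exact: cont01M.
have cE2' l := cont01M (cBS l) (cE2 l).
rewrite /E2 -int01_sum// -int01D//; last first.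
- exact: cont01_sum.
- exact: cont01M.
apply: eq_int01 => c _.
under eq_bigr do rewrite -mulrA; rewrite -mulr_sumr -mulrDr; congr (_ * _).
(* Here S Pi G is subtracted and added between the velocity and the field. *)
rewrite /V /field /projected_field -addrA; congr (_ + _).
under [X in _ + X = _]eq_bigr do rewrite mulrBr.
by rewrite sumrB addKr.
Unshelve. all: by end_near. Qed.

End line_integral_method.

(** * The exact solution against the same Taylor polynomial *)

Section exact_solution.
Context {R : realType}.

Lemma is_derive_scale (f : R -> R) (h c a : R) :
  is_derive (c * h) (1 : R) f a ->
  is_derive c (1 : R) (fun t => f (t * h)) (h * a).
Proof.
move=> df; have dh : is_derive c (1 : R) (fun t : R => t * h) h.
  have -> : (fun t : R => t * h) = horner (h *: 'X).
    by apply/funext => t; rewrite hornerZ hornerX mulrC.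
  apply: (is_derive_eq (is_derive_poly _ _)).
  by rewrite derivZ derivX hornerZ hornerC mulr1.
by rewrite mulrC; exact: (@is_derive1_comp _ f (fun t : R => t * h)).
Qed.

(** Near an interior point of D the restriction to D holds automatically, and u = t + h gives the
    usual difference quotient. *)
Lemma has_derivative_within_derive (V : normedModType R) (D : set R)
    (f : R -> V) t v : nbhs t D -> has_derivative_within D f t v ->
  is_derive t 1 f v.
Proof.
move=> Dt df.
suff Hd : h^-1 *: ((f \o shift t) (h *: (1 : R)) - f t) @[h --> 0^'] --> v.
  apply: DeriveDef; first by apply/cvg_ex; exists v.
  exact/cvg_lim.
move=> A /df HA.
have {}HA : \forall u \near t, u != t -> D u ->
  A ((u - t)^-1 *: (f u - f t)) by [].
have : \forall u \near t, u != t -> A ((u - t)^-1 *: (f u - f t)).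
  by move: HA Dt; apply: filterS2 => u HA Du ut; exact: HA.
rewrite (near_shift 0) subr0 => HA0.
suff : \forall h \near (0 : R), h != 0 ->
  A (h^-1 *: ((f \o shift t) (h *: (1 : R)) - f t)) by [].
move: HA0; apply: filterS => h /= HAh h0.
have -> : h *: (1 : R) = h by exact: mulr1.
by move: HAh; rewrite addrK; apply; rewrite -subr_eq0 addrK.
Qed.

(** Write f(u) as f(0) plus u times the difference quotient; the product tends to 0 v = 0. *)
Lemma has_derivative_within_right (V : normedModType R) (f : R -> V) (T : R) v :
  0 < T -> has_derivative_within `[0, T] f 0 v -> f t @[t --> 0^'+] --> f 0.
Proof.
move=> T0 df.
have dfr : (fun u => (u - 0)^-1 *: (f u - f 0)) @ 0^'+ --> v.
  move=> A /df HA.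
  have {}HA : \forall u \near 0, u != 0 -> `[0, T]%classic u ->
    A ((u - 0)^-1 *: (f u - f 0)) by [].
  have T1 : \forall u \near (0 : R), u < T by exact: lt_nbhsl.
  suff : \forall u \near 0, 0 < u -> A ((u - 0)^-1 *: (f u - f 0)) by [].
  move: HA T1; apply: filterS2 => u HA uT u0; apply: HA.
    by rewrite gt_eqF.
  by rewrite /= in_itv/= (ltW u0) (ltW uT).
have idr : u @[u --> (0:R)^'+] --> (0 : R).
  by apply: cvg_at_right_filter; exact: cvg_id.
have cvg_f : u *: ((u - 0)^-1 *: (f u - f 0)) + f 0 @[u --> 0^'+] --> f 0.
  rewrite -[X in _ --> X]add0r -(scale0r v).
  by apply: cvgD; [exact: cvgZ|exact: cvg_cst].
apply: cvg_trans cvg_f; apply: near_eq_cvg.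
near=> u; have u0 : u != 0 by rewrite gt_eqF//; near: u; exact: nbhs_right_gt.
by rewrite /= subr0 scalerA mulfV// scale1r subrK.
Unshelve. all: by end_near. Qed.

(** The defect vanishes along the exact solution, leaving h times the top Taylor term, bounded on K.
    The mean value theorem is used because at t = 0 the solution is only controlled from the
    right. *)
Lemma local_error_exact m (S : 'cV[R]_m -> 'M[R]_m) (H : 'cV[R]_m -> R)
    (U K : set 'cV[R]_m) (y0 : 'cV[R]_m) (T : R)
    (y : R -> 'cV[R]_m) N k :
  open U -> is_smooth U S -> is_smooth U (grad H) -> compact K ->
  nbhs y0 K -> K `<=` U -> 0 < T -> is_solution S H y0 T y ->
  right_bigO N.+1
    (fun h => y h k 0 - flow_taylor S (grad H) N h k 0 y0).
Proof.
move=> U_open sS sG cK y0K KU T0 [y_0 dy]; pose G := grad H.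
have sLie := lie_smooth U_open sS sG.
have [M M0 lieM] : exists2 M : R, 0 <= M &
    forall x, K x -> `|lie S G N.+1 k x| <= M.
  apply: (continuous_compact_bounded cK KU) => z Uz.
  exact: is_smooth_continuous Uz.
have y_right : y t @[t --> 0^'+] --> y0.
  rewrite -y_0; apply: (has_derivative_within_right T0); apply: dy.
  by rewrite in_itv/= lexx ltW.
(* Right continuity at 0 keeps the solution in the neighborhood K of y0 for a short time. *)
have [e /= e0 yK] : exists2 e : R, 0 < e & forall t, 0 <= t -> t < e -> K (y t).
  have [e /= e0 He] := y_right _ y0K; exists e => // t t0 te.
  have [<-|tn0] := eqVneq 0 t; first by rewrite y_0; exact: nbhs_singleton.
  by apply: He; [rewrite /= sub0r normrN ger0_norm|rewrite lt_def eq_sym tn0].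
exists M => //.
near=> h; have h0 : 0 < h by near: h; exact: nbhs_right_gt.
(* The strict bound makes c h an interior point of [0, T] even for c = 1. *)
have hT : h < T by near: h; exact: nbhs_right_lt.
have he : h < e by near: h; exact: nbhs_right_lt.
pose x c := y (c * h).
have xK (c : R) : 0 <= c -> c <= 1 -> K (x c).
  move=> c0 c1; apply: yK; first by rewrite mulr_ge0// ltW.
  by rewrite (le_lt_trans _ he)// ler_piMl// ltW.
pose F c := flow_taylor S G N h k c (x c).
pose dF c := h * ((time_poly h N).[c] * lie S G N.+1 k (x c)).
have dFE (c : R) : 0 < c -> c <= 1 -> is_derive c (1 : R) F (dF c).
  move=> c0 c1; have ch0 : 0 < c * h by rewrite mulr_gt0.
  have chT : c * h < T by rewrite (le_lt_trans _ hT)// ler_piMl// ltW.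
  have chI : c * h \in `[0, T] by rewrite in_itv/= (ltW ch0) (ltW chT).
  have nD : nbhs (c * h) `[0, T]%classic.
    have : nbhs (c * h) `]0, T[%classic.
      by apply: near_in_itvoo; rewrite in_itv/= ch0 chT.
    by apply: filterS => z; exact: subset_itv_oo_cc.
  have [dyc dycE] := has_derivative_within_derive nD (dy _ chI).
  have dxj j : is_derive c (1 : R) (fun t => x t j 0) (h * field S G j (x c)).
    apply: (is_derive_scale (f := fun t => y t j 0)).
    apply: DeriveDef; first by move/derivable_mxP : dyc; exact.
    have := congr1 (fun A : 'cV[R]_m => A j 0) dycE.
    by rewrite derive_mx// !mxE => ->.
  have Uxc : U (x c) by apply/KU/xK => //; exact: ltW.
  apply: (is_derive_eq (is_derive_flow_taylor U_open sS sG N k Uxc dxj)).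
  by rewrite big1 ?addr0// => j _; rewrite subrr mulr0.
have F_cont (c : R) : 0 < c -> c <= 1 -> {for c, continuous F}.
  move=> c0 c1; apply: differentiable_continuous; apply/derivable1_diffP.
  by have [] := dFE c c0 c1.
have cF : {within `[0, 1], continuous F}.
  apply/continuous_within_itvP => //; split.
  - by move=> c; rewrite in_itv/= => /andP[c0 c1]; exact: F_cont (ltW c1).
  (* At c = 0 the right limit is taken term by term, using right continuity of y and continuity of
     the Lie derivatives at y0. *)
  - apply: cvg_big => [|n _]; first exact: add_continuous.
    apply: cvgM; first by apply: cvg_at_right_filter; exact: continuous_horner.
    have Uy0 : U y0 by apply: KU; exact: nbhs_singleton.
    have lie_c := is_smooth_continuous (sLie n k) Uy0.
    rewrite /x mul0r y_0; apply: continuous_cvg; first exact: lie_c.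
    apply: (@cvg_comp _ _ _ (fun c => c * h) y _ (0:R)^'+); last exact: y_right.
    move=> A [d /= d0 HA]; exists (d / h); first by rewrite /= divr_gt0.
    move=> c /=; rewrite sub0r normrN ltr_pdivlMr// => cd c0.
    by apply: HA; rewrite /= ?mulr_gt0// sub0r normrN normrM (gtr0_norm h0).
  - by apply: cvg_at_left_filter; exact: F_cont.
have dF01 (c : R) : c \in `]0, 1[ -> is_derive c (1 : R) F (dF c).
  by rewrite in_itv/= => /andP[c0 c1]; exact: dFE (ltW c1).
have [c cI] := MVT_segment ler01 dF01 cF.
rewrite /F flow_taylor1 {1 2}/x mul1r mul0r y_0 => ->; rewrite subr0 mulr1.
have := cI; rewrite in_itv/= => /andP[c0 c1].
rewrite /dF !normrM (gtr0_norm h0) exprS [leRHS]mulrCA ler_pM2l// mulrC.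
apply: ler_pM => //; first exact/lieM/xK.
exact: time_poly_le.
Unshelve. all: by end_near. Qed.

End exact_solution.

(** * The method in projected form *)

(** Exchanging finite sums and integral, sum_j rho_ij gamma_j is the i-th Legendre coefficient of S
    Pi grad H. *)
Lemma projected_field_Gamma (R : realType) (m s : nat) (P : nat -> {poly R})
    (S : 'cV[R]_m -> 'M[R]_m) (H : 'cV[R]_m -> R) (h c : R)
    (sigma : R -> R -> 'cV[R]_m) (k : 'I_m) :
  (forall l, cont01 (fun t => S (sigma h (t * h)) k l)) ->
  (\sum_(0 <= i < s) (P i).[c] *: Gamma P S H h s (sigma h) i) k 0 =
  (lproj P s
    (projected_field S (grad H) P s (fun h t => sigma h (t * h)) k h)).[c].
Proof.
move=> cS; rewrite big_mkord summxE horner_sum; apply: eq_bigr => i _.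
rewrite mxE hornerZ mulrC; congr (_ * _).
pose g l j := int01 (fun t => (P j).[t] * grad H (sigma h (t * h)) l 0).
transitivity (int01 (fun t => \sum_l \sum_(j < s)
    g l j * ((P i).[t] * (P j).[t] * S (sigma h (t * h)) k l))).
  have cPPS j l : cont01 (fun t =>
      (P i).[t] * (P j).[t] * S (sigma h (t * h)) k l).
    by apply: cont01M => //; apply: cont01M; exact: cont01_horner.
  have cgPPS j l : cont01 (fun t =>
      g l j * ((P i).[t] * (P j).[t] * S (sigma h (t * h)) k l)).
    by apply: cont01M => //; exact: cont01_cst.
  rewrite int01_sum; last by move=> l; exact: cont01_sum.
  rewrite /Gamma big_mkord summxE; under eq_bigr do rewrite mxE.
  rewrite exchange_big; apply: eq_bigr => l _ /=.
  rewrite int01_sum//; apply: eq_bigr => j _.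
  by rewrite int01Zl// !mxE mulrC.
apply: eq_int01 => t _; rewrite mulr_sumr; apply: eq_bigr => l _.
rewrite horner_sum !mulr_sumr; apply: eq_bigr => j _.
by rewrite hornerZ /g; ring.
Qed.

Lemma derivable_poly_path (R : realType) (m : nat) (p : 'cV[{poly R}]_m)
    (t : R) :
  derivable (poly_path p) t 1.
Proof.
apply/derivable_mxP => i j; rewrite (_ : (fun _ => _) = horner (p i 0)).
  exact: derivable_horner.
by apply/funext => z; rewrite mxE.
Qed.

Lemma is_derive_poly_path (R : realType) (m : nat) (p : 'cV[{poly R}]_m)
    (t : R) k :
  is_derive t 1 (fun u => poly_path p u k 0) ((poly_path p)^`()%classic t k 0).
Proof.
have dp : derivable (poly_path p) t 1 by exact: derivable_poly_path.
apply: DeriveDef; first by move/derivable_mxP : dp; exact.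
by rewrite derive1E derive_mx// mxE.
Qed.

Lemma col_norm_le (R : realType) (m : nat) (v : 'cV[R]_m) (C : R) : 0 <= C ->
  (forall k, `|v k 0| <= C) -> `|v| <= C.
Proof.
move=> C0 vC; rewrite /Num.Def.normr/= mx_normrE.
apply: bigmax_le => // -[i j] _; by rewrite (ord1 j); exact: vC.
Qed.

(** * Assembly of the order estimate *)

Unset Implicit Arguments.

Theorem theorem2 (R : realType) (m s : nat) (P : nat -> {poly R})
  (S : 'cV[R]_m -> 'M[R]_m) (H : 'cV[R]_m -> R) (y0 : 'cV[R]_m)
  (U K : set 'cV[R]_m) (T : R) (y : R -> 'cV[R]_m)
  (sigma : R -> 'cV[{poly R}]_m)
  (s_ge1 : (1 <= s)%N)
  (P_legendre : orthonormal_legendre P)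
  (S_skew : forall x, S x = - (S x)^T)
  (U_open : open U)
  (S_smooth : is_smooth U S)
  (H_diff : forall x, U x -> differentiable H x)
  (gradH_smooth : is_smooth U (grad H))
  (K_compact : compact K)
  (K_nbhs : nbhs y0 K)
  (K_sub : K `<=` U)
  (T_gt0 : 0 < T)
  (y_sol : is_solution S H y0 T y)
  (sigma_sol : \forall h \near 0^'+,
     is_approximation s P S H y0 h (sigma h) /\
     forall t : R, t \in `[0, h] -> K (poly_path (sigma h) t)) :
  (fun h => poly_path (sigma h) h - y h) =O_ (0^'+) (fun h => h ^+ (2 * s + 1)).
Proof.
pose x h c := poly_path (sigma h) (c * h).
have scale_itv (h c : R) : 0 < h -> c \in `[0, 1] -> c * h \in `[0, h].
  rewrite !in_itv/= => h0 /andP[c0 c1].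
  by rewrite mulr_ge0 ?(ltW h0)//= ler_piMl// ltW.
have x0 : \forall h \near 0^'+, x h 0 = y0.
  by move: sigma_sol; apply: filterS => h [[_ p0 _] _]; rewrite /x mul0r.
have xK : \forall h \near 0^'+, forall c : R, c \in `[0, 1] -> K (x h c).
  move: sigma_sol (@near_right01 R).
  apply: filterS2 => h [_ pK] /andP[h0 _] c cI.
  exact: pK (scale_itv _ _ h0 cI).
have dx : \forall h \near 0^'+, forall c : R, c \in `[0, 1] -> forall k,
    is_derive c (1 : R) (fun t => x h t k 0)
      (h * (lproj P s (projected_field S (grad H) P s x k h)).[c]).
  move: sigma_sol xK; apply: filterS2 => h [[_ _ dp] _] xKh c cI k.
  apply: (is_derive_scale (f := fun t => poly_path (sigma h) t k 0)).
  (* The defining equation of the method becomes sigma' = Pi (S Pi grad H). *)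
  rewrite -(@projected_field_Gamma R m s P S H h c
    (fun h => poly_path (sigma h))).
    by rewrite -dp//; exact: is_derive_poly_path.
  move=> l t tI.
  apply: (@continuous_comp _ _ _ (x h) (fun z => S z k l)); last first.
    apply: (is_smooth_continuous (is_smooth_entry U_open k l S_smooth)).
    by apply: K_sub; exact: xKh.
  apply: (@continuous_comp R R 'cV[R]_m (fun t => t * h)
    (poly_path (sigma h)) t).
    by apply: cvgM; [exact: cvg_id|exact: cvg_cst].
  apply: differentiable_continuous; apply/derivable1_diffP.
  exact: derivable_poly_path.
(* Both end points are compared with the same Taylor value at y0 and c = 0, which cancels. *)
have err k : right_bigO (2 * s).+1
    (fun h => poly_path (sigma h) h k 0 - y h k 0).
  have E1 := local_error_approximation U_open S_smooth gradH_smooth K_compact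
    K_sub P_legendre x0 xK dx k.
  have E2 := local_error_exact (2 * s) k U_open S_smooth gradH_smooth K_compact
    K_nbhs K_sub T_gt0 y_sol.
  apply: right_bigO_ext (right_bigOD E1 (right_bigON E2)).
  by apply: nearW => h; rewrite /x mul1r opprB addrA subrK.
have /choice[C HC] k : exists C : R, 0 <= C /\ \forall h \near 0^'+,
    `|poly_path (sigma h) h k 0 - y h k 0| <= C * h ^+ (2 * s).+1.
  by have [C C0 HC] := err k; exists C.
(* The sum dominates every coordinate constant, as the max norm requires, and the summand 1 makes
   the constant positive. *)
apply/eqO_exP; exists (1 + \sum_k C k).
  by rewrite ltr_pwDl// sumr_ge0// => k _; have [] := HC k.
have : \forall h \near 0^'+, forall k,
    `|poly_path (sigma h) h k 0 - y h k 0| <= C k * h ^+ (2 * s).+1.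
  by apply: filter_forall => k; have [] := HC k.
move: (@near_right01 R); apply: filterS2 => h /andP[h0 _] Hh.
rewrite addn1 normrX (gtr0_norm h0).
have hn : 0 <= h ^+ (2 * s).+1 by rewrite exprn_ge0// ltW.
have CS k : C k <= 1 + \sum_k C k.
  rewrite (bigD1 k)//= addrCA lerDl addr_ge0// sumr_ge0// => j _.
  by have [] := HC j.
apply: col_norm_le => [|k].
  rewrite mulr_ge0// addr_ge0// sumr_ge0// => k _.
  by have [] := HC k.
by rewrite mxE [X in _ + X]mxE; apply: (le_trans (Hh k)); rewrite ler_wpM2r.
Qed.
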